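(* Let $\varphi\colon\mathbb{R}^n\times\mathbb{R}^m\to\overline{\mathbb{R}}$ be proper and lower semicontinuous, let $h(x):=\inf_{y\in\mathbb{R}^m}\varphi(x,y)$ be its marginal function and $\Psi(x):=\operatorname{argmin}_{y\in\mathbb{R}^m}\varphi(x,y)$ its solution mapping. Fix $\bar x\in\operatorname{dom}\Psi$ and let $\Psi$ be inner semicompact at $\bar x$. Then for each $x^*\in\mathbb{R}^n$ and $u\in\mathbb{R}^n$, $$\text{(i)}\quad \mathrm{d}h(\bar x)(u)\ \le\ \inf_{y\in\Psi(\bar x),\,v\in\mathbb{R}^m}\mathrm{d}\varphi(\bar x,y)(u,v),$$ $$\text{(ii)}\quad \mathrm{d}^2h(\bar x;x^* )(u)\ \le\ \inf_{y\in\Psi(\bar x),\,v\in\mathbb{R}^m}\mathrm{d}^2\varphi((\bar x,y);(x^*,0))(u,v).$$ On the other hand, suppose that $\Psi$ is inner calm* at $\bar x$ in direction $u$. Then (i) and (ii) hold as equalities, and whenever $\mathrm{d}h(\bar x)(u)$ is finite, both infima are attained at some (common) pair $(y,v)\in\mathbb{R}^m\times\mathbb{R}^m$ with $y\in\Psi(\bar x)$ and $v\in D\Psi(\bar x,y)(u)$.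
   Context: $\overline{\mathbb{R}}:=\mathbb{R}\cup\{-\infty,\infty\}$. A function is proper if it never takes the value $-\infty$ and is finite somewhere. By convention $\Psi(x):=\varnothing$ if $\varphi(x,y)=\infty$ for all $y$; $\operatorname{dom}\Psi:=\{x\mid\Psi(x)\neq\varnothing\}$. For a function $h\colon\mathbb{R}^n\to\overline{\mathbb{R}}$ and $\bar z$ with $|h(\bar z)|<\infty$, the subderivative is $\mathrm{d}h(\bar z)(w):=\liminf_{t\downarrow0,\,w'\to w}\frac{h(\bar z+tw')-h(\bar z)}{t}$, and for $z^*\in\mathbb{R}^n$ the second subderivative is $\mathrm{d}^2h(\bar z;z^* )(w):=\liminf_{t\downarrow0,\,w'\to w}\frac{h(\bar z+tw')-h(\bar z)-t\langle z^*,w'\rangle}{\frac12t^2}$. $\Psi$ is inner semicompact at $\bar x$ if for each sequence $x_k\to\bar x$ there exist $y\in\mathbb{R}^m$, a subsequence $x_{k_\ell}$, and $y_\ell\to y$ with $y_\ell\in\Psi(x_{k_\ell})$ for each $\ell$. $\Psi$ is inner calm* at $\bar x$ in direction $u$ if there is $\kappa>0$ such that for each sequence $x_k=\bar x+t_ku_k$ with $t_k\downarrow0$, $u_k\to u$, there exist $y\in\mathbb{R}^m$, a subsequence $x_{k_\ell}$, and $y_\ell\to y$ with $y_\ell\in\Psi(x_{k_\ell})$ and $\|y_\ell-y\|\le\kappa\|x_{k_\ell}-\bar x\|$ for each $\ell$. The graphical derivative is given by: $v\in D\Psi(\bar x,y)(u)$ iff $(u,v)\in T_{\operatorname{gph}\Psi}(\bar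 x,y)$, where $T_\Omega(\bar z):=\{w\mid\exists t_k\downarrow0,\,w_k\to w\colon\bar z+t_kw_k\in\Omega\ \forall k\}$ is the tangent cone. *)

(* Defs.v *)
(* The space R^k is 'rV[R]_k, and R^n x R^m is identified
   with 'rV[R]_(n + m), the pair (x, y) being row_mx x y. *)
From HB Require Import structures.
From mathcomp Require Import all_boot all_order all_algebra.
From mathcomp Require Import all_classical all_reals all_analysis.

Set Implicit Arguments.
Unset Strict Implicit.
Unset Printing Implicit Defensive.

Import Order.TTheory GRing.Theory Num.Theory.
Import numFieldNormedType.Exports.

Local Open Scope classical_set_scope.
Local Open Scope ring_scope.

Definition dotv (R : realType) (k : nat) (x y : 'rV[R]_k) : R :=
  \sum_(i < k) x 0 i * y 0 i.

(* The library norm `|x| on 'rV[R]_k is the sup norm. *)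
Definition enorm (R : realType) (k : nat) (x : 'rV[R]_k) : R :=
  Num.sqrt (dotv x x).

Definition proper_fun (R : realType) (k : nat) (f : 'rV[R]_k -> \bar R) : Prop :=
  (forall z, f z != -oo%E) /\ (exists z, f z \is a fin_num).

(* The limes inferior as t tends to 0 from the right and w' tends to w
   (w' = w allowed), i.e. along the product filter. These are only meaningful
   when h z is finite. *)
Definition subderivative (R : realType) (k : nat) (h : 'rV[R]_k -> \bar R)
    (z w : 'rV[R]_k) : \bar R :=
  limf_einf
    (fun p : R * 'rV[R]_k =>
       ((h (z + p.1 *: p.2)%R - h z) * (p.1^-1)%R%:E)%E)
    (filter_prod (at_right (0 : R)) (nbhs w)).

Definition second_subderivative (R : realType) (k : nat)
    (h : 'rV[R]_k -> \bar R) (z zs w : 'rV[R]_k) : \bar R :=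
  limf_einf
    (fun p : R * 'rV[R]_k =>
       ((h (z + p.1 *: p.2)%R - h z - (p.1 * dotv zs p.2)%R%:E)
          * ((2^-1 * p.1 ^+ 2)^-1)%R%:E)%E)
    (filter_prod (at_right (0 : R)) (nbhs w)).

Definition marginal (R : realType) (n m : nat)
    (phi : 'rV[R]_(n + m) -> \bar R) (x : 'rV[R]_n) : \bar R :=
  ereal_inf [set phi (row_mx x y) | y in [set: 'rV[R]_m]].

(* Empty where phi (x, .) is identically +oo. *)
Definition solution_map (R : realType) (n m : nat)
    (phi : 'rV[R]_(n + m) -> \bar R) (x : 'rV[R]_n) : set 'rV[R]_m :=
  [set y | (forall y', (phi (row_mx x y) <= phi (row_mx x y'))%E) /\
           (exists y', phi (row_mx x y') != +oo%E)].

Definition dom_map (R : realType) (n m : nat)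
    (Psi : 'rV[R]_n -> set 'rV[R]_m) : set 'rV[R]_n :=
  [set x | Psi x !=set0].

Definition graph_map (R : realType) (n m : nat)
    (Psi : 'rV[R]_n -> set 'rV[R]_m) : set 'rV[R]_(n + m) :=
  [set z | Psi (lsubmx z) (rsubmx z)].

(* "t_k decreases to 0" is the customary shorthand for t_k > 0 and t_k --> 0;
   no monotonicity is intended. *)
Definition to_zero_right (R : realType) (t : nat -> R) : Prop :=
  (forall k, 0 < t k) /\ t @ \oo --> (0 : R).

Definition tangent_cone (R : realType) (k : nat) (Om : set 'rV[R]_k)
    (z : 'rV[R]_k) : set 'rV[R]_k :=
  [set w | exists (t : nat -> R) (wk : nat -> 'rV[R]_k),
     [/\ to_zero_right t, wk @ \oo --> w &
         forall j, Om (z + t j *: wk j)]].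

Definition graphical_derivative (R : realType) (n m : nat)
    (Psi : 'rV[R]_n -> set 'rV[R]_m) (x : 'rV[R]_n) (y : 'rV[R]_m)
    (u : 'rV[R]_n) : set 'rV[R]_m :=
  [set v | tangent_cone (graph_map Psi) (row_mx x y) (row_mx u v)].

Definition inner_semicompact (R : realType) (n m : nat)
    (Psi : 'rV[R]_n -> set 'rV[R]_m) (xbar : 'rV[R]_n) : Prop :=
  forall xk : nat -> 'rV[R]_n, xk @ \oo --> xbar ->
  exists (y : 'rV[R]_m) (s : nat -> nat) (yl : nat -> 'rV[R]_m),
    [/\ increasing_seq s, yl @ \oo --> y & forall l, Psi (xk (s l)) (yl l)].

Definition inner_calm_star (R : realType) (n m : nat)
    (Psi : 'rV[R]_n -> set 'rV[R]_m) (xbar u : 'rV[R]_n) : Prop :=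
  exists2 kappa : R, 0 < kappa &
  forall (t : nat -> R) (uk : nat -> 'rV[R]_n),
    to_zero_right t -> uk @ \oo --> u ->
  exists (y : 'rV[R]_m) (s : nat -> nat) (yl : nat -> 'rV[R]_m),
    [/\ increasing_seq s, yl @ \oo --> y &
        forall l,
          Psi (xbar + t (s l) *: uk (s l)) (yl l) /\
          enorm (yl l - y) <=
            kappa * enorm ((xbar + t (s l) *: uk (s l)) - xbar)].

(* Main.v *)
Require Import Defs.
From mathcomp Require Import all_boot all_order all_algebra.
From mathcomp Require Import all_classical all_reals all_analysis.
From mathcomp Require Import ring lra.
Import Order.TTheory GRing.Theory Num.Theory.
Import numFieldNormedType.Exports.
Local Open Scope classical_set_scope.
Local Open Scope ring_scope.
Set Implicit Arguments.
Unset Strict Implicit.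
Unset Printing Implicit Defensive.

(** Write h for the marginal function and Psi for the solution mapping. Since
    h x <= phi (x, y) everywhere, with equality when y is in Psi x, every
    difference quotient of h at xbar is bounded by the corresponding quotient
    of phi at (xbar, y), y in Psi xbar; passing to the lower limit gives the
    two inequalities ([limf_einf_marginal_le]).

    For the converse, take t_k and u_k along which the quotients of h realize
    their lower limit (assumed < +oo, the other case being trivial). Inner
    calmness* produces, along a subsequence, minimizers y_k of
    phi (xbar + t_k u_k, .) that tend to some y at a speed O(t_k), so that
    v_k := (y_k - y) / t_k is bounded and has a convergent subsequence, with
    limit v. As the quotients are bounded above, the values h (xbar + t_k u_k)
    do not stay above h xbar, and lower semicontinuity of phi then puts y in
    Psi xbar ([solution_limit], [inner_calm_star_selection]). By construction v
    lies in the graphical derivative, and the quotients of phi along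
    (t_k, (u_k, v_k)) are those of h, so the pair (y, v) attains the infimum
    ([marginal_attained]). First- and second-order quotients differ only by
    their denominator and linear term, and are treated together.

    The first- and second-order statements produce a priori different pairs.
    They can be merged because the second subderivative is governed by the
    comparison of the first one with the slope <zs, w>: it is -oo when the
    subderivative is below the slope ([second_subderivative_eqNy]), and
    conversely a value < +oo forces the subderivative to be at most the slope
    ([subderivative_le_dotv]). So if dh(u) < <xs, u>, or if the second
    subderivative of h is +oo, a pair attaining the first infimum also attains
    the second one; otherwise a pair attaining the second infimum also attains
    the first one. *)

(** * Lower limits along a filter *)

Lemma lee_fin_above (R : realType) (x l : \bar R) :
  (forall r : R, (l < r%:E)%E -> (x <= r%:E)%E) -> (x <= l)%E.
Proof.
case: l => [l| |] H; last 2 first.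
- exact: leey.
- case: x H => [x| |] H //.
  + by have := H (x - 1)%R (ltNyr _); rewrite lee_fin lerBrDl gerDr ler10.
  + by have := H 0 (ltNyr _).
apply/lee_addgt0Pr => e e0; rewrite -EFinD; apply: H.
by rewrite lte_fin ltrDl.
Qed.

Lemma lt_fin_dense (R : realType) (x : \bar R) (b : R) : (x < b%:E)%E ->
  exists2 a : R, (x < a%:E)%E & a < b.
Proof.
case: x => [x| |] //.
- rewrite lte_fin => xb; exists ((x + b) / 2).
    by rewrite lte_fin (midf_lt xb).
  by rewrite (midf_lt xb).
- by move=> _; exists (b - 1); rewrite ?ltNyr// ltrBlDr ltrDl.
Qed.

(** Together with the next lemma, this turns bounds on a lower limit into
    statements with real bounds only: limf_einf f F <= l iff, for each real
    r > l, the inequality f <= r holds frequently along F. Infinite and finite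
    lower limits need no separate treatment afterwards. *)
Lemma limf_einf_lt_ex (R : realType) (T : choiceType) (X : filteredType T)
    (f : X -> \bar R) (F : set (set X)) (r : R) (A : set X) :
  (limf_einf f F < r%:E)%E -> F A -> exists2 p, A p & (f p <= r%:E)%E.
Proof.
rewrite limf_einfE => fr FA.
have /ereal_inf_lt[_ [p Ap <-] /ltW fp] : (ereal_inf (f @` A) < r%:E)%E.
  by apply: le_lt_trans fr; apply: ereal_sup_ubound; exists A.
by exists p.
Qed.

Lemma limf_einf_le (R : realType) (T : choiceType) (X : filteredType T)
    (f : X -> \bar R) (F : set (set X)) (l : \bar R) :
  (forall r : R, (l < r%:E)%E -> forall A, F A ->
    exists2 p, A p & (f p <= r%:E)%E) ->
  (limf_einf f F <= l)%E.
Proof.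
rewrite limf_einfE => H; apply: ge_ereal_sup => _ [A FA <-].
apply: lee_fin_above => r lr; have [p Ap fp] := H r lr A FA.
by apply: le_trans fp; apply: ereal_inf_lbound; exists p.
Qed.

(** Supplies the tolerances with which points nearly realizing a lower limit l
    are picked, uniformly in whether l is a real or -oo. *)
Lemma level_sequence (R : realType) (l : \bar R) : (l < +oo)%E ->
  exists a : nat -> R, (forall k, (l < (a k)%:E)%E) /\
    forall r : R, (l < r%:E)%E -> \forall k \near \oo, a k <= r.
Proof.
case: l => [l| |] // _.
  exists (fun k => l + k.+1%:R^-1); split=> [k|r].
    by rewrite lte_fin ltrDl invr_gt0.
  rewrite lte_fin -subr_gt0 => lr.
  near=> k; rewrite -lerBrDl ltW//.
  by near: k; exact: near_infty_natSinv_lt (PosNum lr).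
exists (fun k => - k%:R); split=> [k|r _]; first exact: ltNyr.
by near=> k; rewrite lerNl ltW//; near: k; exact: nbhs_infty_gtr.
Unshelve. all: by end_near. Qed.

(** * The directional filter *)

Definition approach (R : realType) (k : nat) (w : 'rV[R]_k) :=
  filter_prod (at_right (0 : R)) (nbhs w).

Lemma approach_ball (R : realType) (k : nat) (w : 'rV[R]_k) (e : R) : 0 < e ->
  approach w [set p | [/\ 0 < p.1, p.1 < e & `|w - p.2| < e]].
Proof.
move=> e0; exists ([set t | 0 < t < e], [set w' | `|w - w'| < e]) => /=.
  split.
    near=> t; apply/andP; split; near: t.
      exact: nbhs_right_gt.
    exact: nbhs_right_lt.
  by have /cvgrPdist_lt := (@cvg_id _ (nbhs w)); apply.
by move=> [t w'] /= [/andP[]].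
Unshelve. all: by end_near. Qed.

Global Instance approach_filter (R : realType) (k : nat) (w : 'rV[R]_k) :
  Filter (approach w).
Proof. exact: filter_prod_filter. Qed.

Lemma approach_gt0 (R : realType) (k : nat) (w : 'rV[R]_k) :
  \forall p \near approach w, 0 < p.1.
Proof. by apply: filterS (approach_ball w ltr01) => p []. Qed.

Lemma approach_small (R : realType) (k : nat) (w : 'rV[R]_k) (C e : R) :
  0 < e -> \forall p \near approach w, p.1 * C < e.
Proof.
move=> e0; have C0 : 0 < `|C| + 1 by rewrite ltr_pwDr.
apply: filterS (approach_ball w (divr_gt0 e0 C0)) => p [p0 pe _].
rewrite ltr_pdivlMr// in pe; apply: le_lt_trans pe.
by rewrite ler_pM2l// (le_trans (ler_norm _))// lerDl.
Qed.

Lemma approach_seq (R : realType) (k : nat) (w : 'rV[R]_k) (t : nat -> R)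
    (wk : nat -> 'rV[R]_k) (A : set (R * 'rV[R]_k)) :
  to_zero_right t -> wk @ \oo --> w -> approach w A ->
  \forall j \near \oo, A (t j, wk j).
Proof.
move=> [t0 tc] wc [[B C] /= [Bn Cn] BC].
have Bj : \forall j \near \oo, B (t j).
  have H : \forall j \near \oo, 0 < t j -> B (t j) := tc _ Bn.
  by apply: filterS H => j /(_ (t0 j)).
have Cj : \forall j \near \oo, C (wk j) by exact: wc.
by apply: filterS2 Bj Cj => j Bj Cj; exact: BC.
Qed.

(** The filter has the countable basis of [approach_ball], so a lower limit is
    realized along a sequence. Only the upper bounds are recorded: lower ones
    hold along every sequence that converges for this filter. *)
Lemma limf_einf_seq (R : realType) (k : nat) (w : 'rV[R]_k)
    (f : R * 'rV[R]_k -> \bar R) :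
  (limf_einf f (approach w) < +oo)%E ->
  exists (t : nat -> R) (wk : nat -> 'rV[R]_k),
    [/\ to_zero_right t, wk @ \oo --> w &
      forall r : R, (limf_einf f (approach w) < r%:E)%E ->
        \forall j \near \oo, (f (t j, wk j) <= r%:E)%E].
Proof.
move=> /level_sequence[a [la ar]].
have /choice[p Hp] : forall j : nat, exists p : R * 'rV[R]_k,
    [/\ 0 < p.1, p.1 < j.+1%:R^-1, `|w - p.2| < j.+1%:R^-1 &
       (f p <= (a j)%:E)%E].
  move=> j.
  have j0 : 0 < j.+1%:R^-1 :> R by rewrite invr_gt0.
  have [p [p0 pj wp] fp] := limf_einf_lt_ex (la j) (approach_ball w j0).
  by exists p.
exists (fun j => (p j).1), (fun j => (p j).2); split.
- split=> [j|]; first by case: (Hp j).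
  apply/cvgrPdist_lt => e e0; near=> j.
  have [p0 pj _ _] := Hp j.
  rewrite sub0r normrN gtr0_norm//; apply: lt_trans pj _.
  by near: j; exact: near_infty_natSinv_lt (PosNum e0).
- apply/cvgrPdist_lt => e e0; near=> j.
  have [_ _ wp _] := Hp j; apply: lt_trans wp _.
  by near: j; exact: near_infty_natSinv_lt (PosNum e0).
- move=> r /ar; apply: filterS => j ajr.
  have [_ _ _ fp] := Hp j; rewrite -surjective_pairing (le_trans fp)//.
Unshelve. all: by end_near. Qed.

(** * Convergence in spaces of row vectors *)

Lemma continuous_dotv (R : realType) (k : nat) (z : 'rV[R]_k) :
  continuous (dotv z).
Proof.
apply: (continuous_big (@add_continuous R)) => i _ w.
by apply: continuousM; [exact: cst_continuous|exact: coord_continuous].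
Qed.

Lemma approach_dotv (R : realType) (k : nat) (w z : 'rV[R]_k) (A : set R) :
  nbhs (dotv z w) A -> \forall p \near approach w, A (dotv z p.2).
Proof.
move=> nA; exists (setT, dotv z @^-1` A) => /=; last by move=> p [].
by split; [exact: filterT|exact: continuous_dotv].
Qed.

Lemma continuous_enorm (R : realType) (k : nat) : continuous (@enorm R k).
Proof.
move=> w; apply: (@continuous_comp _ _ _ (fun x => dotv x x) Num.sqrt).
  apply: (continuous_big (@add_continuous R)) => i _ x.
  by apply: continuousM; exact: coord_continuous.
exact: sqrt_continuous.
Qed.

Lemma enormZ (R : realType) (k : nat) (a : R) (x : 'rV[R]_k) :
  enorm (a *: x) = `|a| * enorm x.
Proof.
rewrite /enorm -sqrtr_sqr -sqrtrM ?sqr_ge0//; congr Num.sqrt.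
by rewrite /dotv mulr_sumr; apply: eq_bigr => i _; rewrite !mxE; ring.
Qed.

Lemma ler_coord_enorm (R : realType) (k : nat) (x : 'rV[R]_k) (i : 'I_k) :
  `|x 0 i| <= enorm x.
Proof.
rewrite -sqrtr_sqr ler_wsqrtr// /dotv (bigD1 i)//= expr2 lerDl.
by apply: sumr_ge0 => j _; rewrite -expr2 sqr_ge0.
Qed.

Lemma cvg_coord (R : realType) (a b : nat) (T : Type) (F : set_system T)
    (f : T -> 'M[R]_(a, b)) (M : 'M[R]_(a, b)) : Filter F ->
  (forall i j, (f x i j) @[x --> F] --> M i j) -> f @ F --> M.
Proof.
move=> FF fM; apply/cvgrPdist_lt => e e0.
have H i j : \forall x \near F, `|M i j - f x i j| < e.
  by have /cvgrPdist_lt := fM i j; apply.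
have /filter_forall : forall ij : 'I_a * 'I_b,
  \forall x \near F, `|M ij.1 ij.2 - f x ij.1 ij.2| < e by move=> ij; exact: H.
apply: filterS => x Hx.
rewrite [ltLHS]/Num.norm/= mx_normrE; apply/bigmax_ltP; split=> // ij _.
by rewrite !mxE.
Qed.

Lemma near_subseq (P : set nat) (s : nat -> nat) :
  increasing_seq s -> (\forall j \near \oo, P j) ->
  \forall j \near \oo, P (s j).
Proof.
move=> s_incr [N _ NP]; exists N => // j /= Nj; apply: NP => /=.
apply: leq_trans Nj _; elim: j => // j IH; apply: leq_ltn_trans IH _.
by move/increasing_seqP : s_incr; exact.
Qed.

Lemma cvg_subseq (T : Type) (u : nat -> T) (F : set_system T) (s : nat -> nat) :
  increasing_seq s -> u @ \oo --> F -> (u \o s) @ \oo --> F.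
Proof. by move=> s_incr uF A FA; exact: (near_subseq s_incr (uF A FA)). Qed.

Lemma cvg_row_mx (R : realType) (n m : nat) (T : Type)
    (F : set_system T) (f : T -> 'rV[R]_n) (g : T -> 'rV[R]_m)
    (u : 'rV[R]_n) (v : 'rV[R]_m) :
  Filter F -> f @ F --> u -> g @ F --> v ->
  (row_mx (f x) (g x)) @[x --> F] --> row_mx u v.
Proof.
move=> FF fu gv; apply: cvg_coord => i j.
case: (split_ordP j) => k ->.
  under eq_fun do rewrite row_mxEl.
  rewrite row_mxEl.
  exact: (continuous_cvg _ (@coord_continuous R 1 n i k u) fu).
under eq_fun do rewrite row_mxEr.
rewrite row_mxEr.
exact: (continuous_cvg _ (@coord_continuous R 1 m i k v) gv).
Qed.

Lemma bolzano_weierstrass_rV (R : realType) (m : nat) (v : nat -> 'rV[R]_m)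
    (K : R) :
  (forall j i, `|v j 0 i| <= K) ->
  exists (s : nat -> nat) (w : 'rV[R]_m),
    increasing_seq s /\ (v \o s) @ \oo --> w.
Proof.
move=> vK.
suff /(_ m)[s [si sc]] : forall d : nat, exists s : nat -> nat,
    increasing_seq s /\
    forall i : 'I_m, (i < d)%N -> cvgn (fun j => v (s j) 0 i).
  exists s, (\row_i limn (fun j => v (s j) 0 i)); split=> //.
  apply: cvg_coord => i0 i; rewrite mxE ord1; exact: sc.
(* One coordinate after the other: refining a subsequence preserves the
   convergence of the coordinates already treated. *)
elim=> [|d [s [si sc]]]; first by exists id.
have [dm|md] := ltnP d m; last first.
  by exists s; split=> // i _; apply: sc; apply: leq_trans md.
have [s' s'i s'c] : exists2 s' : nat -> nat, increasing_seq s' &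
    cvgn ((fun j => v (s j) 0 (Ordinal dm)) \o s').
  apply: bolzano_weierstrass; exists K; split; first exact: num_real.
  by move=> M KM j _ /=; apply: le_trans (vK _ _) (ltW KM).
exists (s \o s'); split=> [j l|i]; first by rewrite /= si; exact: s'i.
rewrite ltnS leq_eqVlt => /predU1P[id|id].
  by have -> : i = Ordinal dm by exact: val_inj.
exact: (cvgP _ (cvg_subseq s'i (sc i id))).
Qed.

(** * Difference quotients of first and second order *)

(** The first-order quotient is the case rho t = t, zs = 0, the second-order one
    the case rho t = t ^ 2 / 2. *)
Definition quot (R : realType) (k : nat) (rho : R -> R)
    (h : 'rV[R]_k -> \bar R) (z zs : 'rV[R]_k) (p : R * 'rV[R]_k) : \bar R :=
  ((h (z + p.1 *: p.2)%R - h z - (p.1 * dotv zs p.2)%R%:E)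
     * ((rho p.1)^-1)%R%:E)%E.

(** Clearing the denominator gives a form with no extended-real arithmetic,
    whatever the value of h at the perturbed point, infinite or not. *)
Lemma quot_leP (R : realType) (k : nat) (rho : R -> R)
    (h : 'rV[R]_k -> \bar R) (z zs : 'rV[R]_k) (c : R)
    (p : R * 'rV[R]_k) (r : R) :
  h z = c%:E -> 0 < rho p.1 ->
  (quot rho h z zs p <= r%:E)%E =
  (h (z + p.1 *: p.2)%R <= (c + p.1 * dotv zs p.2 + r * rho p.1)%:E)%E.
Proof.
move=> hz rho0; rewrite /quot hz lee_pdivrMr//.
case: (h _) => [a| |].
- by rewrite -!EFinB -EFinM !lee_fin; apply/idP/idP; lra.
- by [].
- by rewrite !leNye.
Qed.

Lemma dot0v (R : realType) (k : nat) (w : 'rV[R]_k) : dotv 0 w = 0.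
Proof. by rewrite /dotv big1// => i _; rewrite mxE mul0r. Qed.

Lemma subderivativeE (R : realType) (k : nat) (h : 'rV[R]_k -> \bar R)
    (z w : 'rV[R]_k) :
  subderivative h z w = limf_einf (quot id h z 0) (approach w).
Proof.
rewrite /subderivative; congr (limf_einf _ _); apply/funext => p.
by rewrite /quot dot0v mulr0 sube0.
Qed.

Definition halfsq (R : realType) (t : R) := 2^-1 * t ^+ 2.

Lemma halfsq_gt0 (R : realType) (t : R) : 0 < t -> 0 < halfsq t.
Proof. by move=> t0; rewrite mulr_gt0// exprn_gt0. Qed.

Lemma cvg_halfsq (R : realType) : halfsq t @[t --> (0 : R)] --> (0 : R).
Proof.
rewrite -[X in _ --> X](mulr0 2^-1) -[X in _ * X](expr0n R 2).
by apply: cvgM; [exact: cvg_cst|exact: exprn_continuous].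
Qed.

Lemma second_subderivativeE (R : realType) (k : nat) (h : 'rV[R]_k -> \bar R)
    (z zs w : 'rV[R]_k) :
  second_subderivative h z zs w =
  limf_einf (quot (@halfsq R) h z zs) (approach w).
Proof. by []. Qed.

Section first_versus_second_order.
Variables (R : realType) (k : nat) (h : 'rV[R]_k -> \bar R) (z : 'rV[R]_k).
Variables (c : R) (hz : h z = c%:E).

(** The second-order quotient is 2 (q - <zs, w'>) / t, with q the first-order
    one. If q is frequently below a level less than <zs, w>, dividing by t
    drives it to -oo. *)
Lemma second_subderivative_eqNy (zs w : 'rV[R]_k) :
  (subderivative h z w < (dotv zs w)%:E)%E ->
  second_subderivative h z zs w = -oo%E.
Proof.
rewrite subderivativeE => /lt_fin_dense[a da aw]; apply/eqP; rewrite -leeNy_eq.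
have {aw} [ab bw] := midf_lt aw; set b := (a + _) / 2 in ab bw.
have ab0 : 0 < b - a by rewrite subr_gt0.
rewrite second_subderivativeE; apply: limf_einf_le => r _ A FA.
have : \forall p \near approach w,
    [/\ A p, 0 < p.1, b < dotv zs p.2 & p.1 * - (r / 2) < b - a].
  by apply: filterS (filterI (filterI FA (approach_gt0 w)) (filterI
    (approach_dotv (lt_nbhsr bw)) (approach_small w (- (r / 2)) ab0)))
    => p [[? ?] []].
move=> FA'; have [p [Ap p0 bp rp]] := limf_einf_lt_ex da FA'.
rewrite (@quot_leP _ _ id _ _ _ c)// dot0v => hp; exists p => //.
rewrite (@quot_leP _ _ _ _ _ _ c)//; last exact: halfsq_gt0.
apply: le_trans hp _; rewrite lee_fin /halfsq.
have : p.1 * (a - p.1 * r / 2) <= p.1 * dotv zs p.2.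
  by rewrite ler_wpM2l ?ltW//; move: bp rp; clear; lra.
by clear; lra.
Qed.

(** Conversely q is <zs, w'> plus t / 2 times the second-order quotient, and
    this last term is at most a vanishing quantity where that quotient is
    bounded above. *)
Lemma subderivative_le_dotv (zs w : 'rV[R]_k) :
  (second_subderivative h z zs w < +oo)%E ->
  (subderivative h z w <= (dotv zs w)%:E)%E.
Proof.
rewrite second_subderivativeE subderivativeE => /level_sequence[Ms [/(_ 0)]].
set M := Ms 0 => dM _.
apply: limf_einf_le => r; rewrite lte_fin => wr A FA.
have {wr} [wb br] := midf_lt wr; set b := (_ + r) / 2 in wb br.
have br0 : 0 < r - b by rewrite subr_gt0.
have : \forall p \near approach w,
    [/\ A p, 0 < p.1, dotv zs p.2 < b & p.1 * (M / 2) < r - b].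
  by apply: filterS (filterI (filterI FA (approach_gt0 w)) (filterI
    (approach_dotv (lt_nbhsl wb)) (approach_small w (M / 2) br0)))
    => p [[? ?] []].
move=> FA'; have [p [Ap p0 bp rp]] := limf_einf_lt_ex dM FA'.
rewrite (@quot_leP _ _ _ _ _ _ c)//; last exact: halfsq_gt0.
move=> hp; exists p => //.
rewrite (@quot_leP _ _ id _ _ _ c)// dot0v.
apply: le_trans hp _; rewrite lee_fin /halfsq.
have : p.1 * (dotv zs p.2 + p.1 * M / 2) <= p.1 * r.
  by rewrite ler_wpM2l ?ltW//; move: bp rp; clear; lra.
by clear; lra.
Qed.

End first_versus_second_order.

(** * The marginal function and its solution mapping *)

Lemma dotv_row_mx0 (R : realType) (n m : nat) (x : 'rV[R]_n)
    (w : 'rV[R]_(n + m)) :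
  dotv (row_mx x 0) w = dotv x (lsubmx w).
Proof.
rewrite /dotv big_split_ord/= [X in _ + X]big1 ?addr0 => [|i _].
  by apply: eq_bigr => i _; rewrite row_mxEl mxE.
by rewrite row_mxEr mxE mul0r.
Qed.

Section marginal_function.
Variables (R : realType) (n m : nat) (phi : 'rV[R]_(n + m) -> \bar R).
Let h := marginal phi.
Let Psi := solution_map phi.

Lemma marginal_le x y : (h x <= phi (row_mx x y))%E.
Proof. by apply: ereal_inf_lbound; exists y. Qed.

Lemma marginal_solution x y : Psi x y -> h x = phi (row_mx x y).
Proof.
move=> [ymin _]; apply/eqP; rewrite eq_le marginal_le andTb.
by apply/le_ereal_inf_tmp => _ [y' _ <-]; exact: ymin.
Qed.

Lemma marginal_fin x y : proper_fun phi -> Psi x y -> h x \is a fin_num.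
Proof.
move=> [phiNy _] xy; rewrite (marginal_solution xy) fin_numE phiNy/=.
case: xy => ymin [y' y'oo]; apply: contra y'oo => /eqP yoo.
by rewrite -leye_eq -yoo.
Qed.

Lemma solution_of_le x y : h x \is a fin_num ->
  (phi (row_mx x y) <= h x)%E -> Psi x y.
Proof.
move=> hfin yh; split=> [y'|]; first exact: le_trans yh (marginal_le _ _).
exists y; rewrite -ltey; apply: le_lt_trans yh _; rewrite ltey.
by move: hfin; rewrite fin_numE => /andP[].
Qed.

Lemma quot_marginal_le (rho : R -> R) (x xs : 'rV[R]_n) (y : 'rV[R]_m)
    (p : R * 'rV[R]_(n + m)) : Psi x y -> 0 < rho p.1 ->
  (quot rho h x xs (p.1, lsubmx p.2) <=
   quot rho phi (row_mx x y) (row_mx xs 0) p)%E.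
Proof.
move=> xy rho0; rewrite /quot/= -(marginal_solution xy) dotv_row_mx0.
rewrite lee_pmul2r ?lte_fin ?invr_gt0// !leeD2r//.
rewrite -[in leRHS](hsubmxK p.2) scale_row_mx add_row_mx; exact: marginal_le.
Qed.

(** Projecting (t, w') to (t, lsubmx w') maps the filter of directions near
    (u, v) to that of directions near u. *)
Lemma limf_einf_marginal_le (rho : R -> R) (x xs u : 'rV[R]_n)
    (y v : 'rV[R]_m) :
  (forall t : R, 0 < t -> 0 < rho t) -> Psi x y ->
  (limf_einf (quot rho h x xs) (approach u) <=
   limf_einf (quot rho phi (row_mx x y) (row_mx xs 0))
     (approach (row_mx u v)))%E.
Proof.
move=> rho0 xy; apply: limf_einf_le => r phir A [[B C] /= [nB nC] BC].
have FA : approach (row_mx u v) [set p | 0 < p.1 /\ A (p.1, lsubmx p.2)].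
  apply: filterI (approach_gt0 _) _.
  exists (B, lsubmx @^-1` C) => /=.
    by split=> //; apply: continuous_lsubmx; rewrite row_mxKl.
  by move=> p [/= Bp Cp]; exact: BC.
have [p [p0 Ap] pr] := limf_einf_lt_ex phir FA.
exists (p.1, lsubmx p.2) => //; apply: le_trans pr.
by apply: quot_marginal_le => //; exact: rho0.
Qed.

Hypothesis phi_lsc : lower_semicontinuous phi.

(** Lower semicontinuity gives phi (x, y) <= h x as soon as h is upper
    semicontinuous at x along the given sequence; without this, the limit of
    minimizers could fail to be one. *)
Lemma solution_limit (xk : nat -> 'rV[R]_n) (yk : nat -> 'rV[R]_m) x y :
  h x \is a fin_num -> xk @ \oo --> x -> yk @ \oo --> y ->
  (forall j, Psi (xk j) (yk j)) ->
  (forall e : R, 0 < e -> \forall j \near \oo, (h (xk j) <= h x + e%:E)%E) ->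
  Psi x y.
Proof.
move=> hfin xc yc xyk hle; apply: solution_of_le => //.
apply: contrapT => /negP; rewrite -ltNge -(fineK hfin) => hlt.
have [a ha ay] : exists2 a, fine (h x) < a & (a%:E < phi (row_mx x y))%E.
  move: hlt; case: (phi _) => [b| |] //.
    by rewrite lte_fin => /midf_lt[]; exists ((fine (h x) + b) / 2).
  by exists (fine (h x) + 1); rewrite ?ltry// ltrDl.
have [V nV Va] := phi_lsc ay.
have e0 : 0 < a - fine (h x) by rewrite subr_gt0.
have nearV : \forall j \near \oo, V (row_mx (xk j) (yk j)).
  exact: (cvg_row_mx _ xc yc nV).
have [j [/Va + ]] := filter_ex (filterI nearV (hle _ e0)).
rewrite -marginal_solution// -(fineK hfin) -EFinD addrC subrK.
by move=> /lt_le_trans H /H; rewrite ltxx.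
Qed.

(** The calmness estimate is exactly what bounds the rescaled differences
    (y_k - y) / t_k, and thus yields a limit direction v. *)
Lemma inner_calm_star_selection (x u : 'rV[R]_n) (t : nat -> R)
    (uk : nat -> 'rV[R]_n) :
  h x \is a fin_num -> inner_calm_star Psi x u ->
  to_zero_right t -> uk @ \oo --> u ->
  (forall e : R, 0 < e ->
    \forall j \near \oo, (h (x + t j *: uk j)%R <= h x + e%:E)%E) ->
  exists (y v : 'rV[R]_m) (s : nat -> nat) (vk : nat -> 'rV[R]_m),
    [/\ Psi x y, increasing_seq s, vk @ \oo --> v &
      forall j, Psi (x + t (s j) *: uk (s j)) (y + t (s j) *: vk j)].
Proof.
move=> hfin [kappa kappa0 calm] t0 uku hle.
have [y [s [yk [s_incr yky yks]]]] := calm t uk t0 uku.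
have [tgt0 tto0] := t0.
have xkx : (x + t (s j) *: uk (s j)) @[j --> \oo] --> x.
  rewrite -[in X in _ --> X](addr0 x) -(scale0r u).
  apply: cvgD; first exact: cvg_cst.
  apply: cvgZ; first exact: (cvg_subseq s_incr tto0).
  exact: (cvg_subseq s_incr uku).
have Psixy : Psi x y.
  apply: (solution_limit hfin xkx yky) => [j|e e0]; first by case: (yks j).
  exact: (near_subseq s_incr (hle e e0)).
pose vk j := (t (s j))^-1 *: (yk j - y).
have vkE j : yk j = y + t (s j) *: vk j.
  by rewrite scalerA divff ?gt_eqF// scale1r addrC subrK.
have [K vkK] : exists K, forall j i, `|vk j 0 i| <= K.
  have /cvg_seq_bounded[M [_ /(_ (M + 1)) HM]] : cvgn (fun j => enorm (uk j)).
    apply: (cvgP (enorm u)).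
    exact: (continuous_cvg _ (@continuous_enorm R n u) uku).
  exists (kappa * (M + 1)) => j i; apply: le_trans (ler_coord_enorm _ _) _.
  have ts0 := tgt0 (s j).
  rewrite enormZ gtr0_norm ?invr_gt0// ler_pdivrMl//.
  have [_] := yks j; move=> /le_trans; apply.
  rewrite addrC addKr enormZ gtr0_norm// mulrCA ler_pM2l// ler_pM2l//.
  apply: le_trans (ler_norm _) _; apply: HM => //; by rewrite ltrDl.
have [s' [v [s'_incr vkv]]] := bolzano_weierstrass_rV vkK.
exists y, v, (s \o s'), (vk \o s'); split=> //.
- by move=> j l /=; rewrite s_incr; exact: s'_incr.
- by move=> j /=; rewrite -vkE; case: (yks (s' j)).
Qed.

(** Along the selected subsequence y_k is optimal at x + t_k u_k, as y is at x,
    so the quotients of phi equal those of h, whose upper limit is the lower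
    limit at u. *)
Lemma marginal_attained (rho : R -> R) (x xs u : 'rV[R]_n) :
  (forall t : R, 0 < t -> 0 < rho t) -> rho t @[t --> 0] --> (0 : R) ->
  h x \is a fin_num -> inner_calm_star Psi x u ->
  (limf_einf (quot rho h x xs) (approach u) < +oo)%E ->
  exists y v : 'rV[R]_m, [/\ Psi x y, graphical_derivative Psi x y u v &
    (limf_einf (quot rho phi (row_mx x y) (row_mx xs 0))
       (approach (row_mx u v)) <=
     limf_einf (quot rho h x xs) (approach u))%E].
Proof.
move=> rho0 rhoc hfin calm fin.
have [t [uk [t0 uku qle]]] := limf_einf_seq fin.
have [tgt0 tto0] := t0.
have hx : h x = (fine (h x))%:E by rewrite fineK.
(* The quotients are eventually below a real r, so h increases along the
   sequence by at most t_j <xs, u_j> + r * rho t_j, which vanishes. *)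
have hle (e : R) : 0 < e ->
    \forall j \near \oo, (h (x + t j *: uk j)%R <= h x + e%:E)%E.
  move=> e0; have [a [/(_ 0) + _]] := level_sequence fin.
  set r := a 0 => /qle.
  have : (t j * dotv xs (uk j) + r * rho (t j)) @[j --> \oo] -->
      0 * dotv xs u + r * 0.
    apply: cvgD; apply: cvgM => //; last 2 first.
    - exact: cvg_cst.
    - exact: (cvg_comp t rho tto0 rhoc).
    - exact: (continuous_cvg _ (@continuous_dotv R n xs u) uku).
  rewrite mul0r mulr0 addr0 => /cvgr_lt/(_ _ e0); apply: filterS2 => j je.
  rewrite (quot_leP _ _ hx) ?rho0 ?tgt0// => /le_trans; apply.
  by rewrite hx -EFinD lee_fin -addrA lerD2l ltW.
have [y [v [s [vk [xy s_incr vkv xyk]]]]] :=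
  inner_calm_star_selection hfin calm t0 uku hle.
have ts0 : to_zero_right (t \o s).
  by split=> [j|]; [exact: tgt0|exact: (cvg_subseq s_incr tto0)].
have wkw : row_mx (uk (s j)) (vk j) @[j --> \oo] --> row_mx u v.
  by apply: cvg_row_mx => //; exact: (cvg_subseq s_incr uku).
have rowE j : row_mx x y + t (s j) *: row_mx (uk (s j)) (vk j) =
    row_mx (x + t (s j) *: uk (s j)) (y + t (s j) *: vk j).
  by rewrite scale_row_mx add_row_mx.
exists y, v; split=> //.
  exists (t \o s), (fun j => row_mx (uk (s j)) (vk j)); split=> // j.
  by rewrite /graph_map/= rowE row_mxKl row_mxKr.
apply: limf_einf_le => r /qle/(near_subseq s_incr) rs A FA.
have [j [Aj rj]] := filter_ex (filterI (approach_seq ts0 wkw FA) rs).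
exists (t (s j), row_mx (uk (s j)) (vk j)) => //; apply: le_trans rj.
by rewrite /quot/= rowE -!marginal_solution// dotv_row_mx0 row_mxKl.
Qed.

End marginal_function.

Theorem theorem4p5 (R : realType) (n m : nat)
    (phi : 'rV[R]_(n + m) -> \bar R)
    (phi_proper : proper_fun phi)
    (phi_lsc : lower_semicontinuous phi)
    (xbar : 'rV[R]_n)
    (xbar_dom : dom_map (solution_map phi) xbar)
    (Psi_isc : inner_semicompact (solution_map phi) xbar)
    (xs u : 'rV[R]_n) :
  let h := marginal phi in
  let Psi := solution_map phi in
  let inf1 := ereal_inf
    [set subderivative phi (row_mx xbar y) (row_mx u v)
       | y in Psi xbar & v in [set: 'rV[R]_m]] in
  let inf2 := ereal_inf
    [set second_subderivative phi (row_mx xbar y) (row_mx xs 0) (row_mx u v)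
       | y in Psi xbar & v in [set: 'rV[R]_m]] in
  [/\ (subderivative h xbar u <= inf1)%E,
      (second_subderivative h xbar xs u <= inf2)%E &
      inner_calm_star Psi xbar u ->
      [/\ subderivative h xbar u = inf1,
          second_subderivative h xbar xs u = inf2 &
          subderivative h xbar u \is a fin_num ->
          exists (y v : 'rV[R]_m),
            [/\ Psi xbar y,
                graphical_derivative Psi xbar y u v,
                subderivative phi (row_mx xbar y) (row_mx u v) = inf1 &
                second_subderivative phi (row_mx xbar y) (row_mx xs 0)
                  (row_mx u v) = inf2]]].
Proof.
move=> h Psi inf1 inf2.
have [y0 xy0] := xbar_dom.
have hfin : h xbar \is a fin_num := marginal_fin phi_proper xy0.
have d1phiE y v : subderivative phi (row_mx xbar y) (row_mx u v) =
    limf_einf (quot id phi (row_mx xbar y) (row_mx 0 0))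
      (approach (row_mx u v)).
  by rewrite subderivativeE row_mx0.
have le1 y v : Psi xbar y -> (subderivative h xbar u <=
    subderivative phi (row_mx xbar y) (row_mx u v))%E.
  move=> xy; rewrite d1phiE subderivativeE.
  exact: limf_einf_marginal_le.
have le2 y v : Psi xbar y -> (second_subderivative h xbar xs u <=
    second_subderivative phi (row_mx xbar y) (row_mx xs 0) (row_mx u v))%E.
  move=> xy; rewrite !second_subderivativeE.
  by apply: limf_einf_marginal_le => // t; exact: halfsq_gt0.
have inf1_le y v : Psi xbar y ->
    (inf1 <= subderivative phi (row_mx xbar y) (row_mx u v))%E.
  by move=> xy; apply: ereal_inf_lbound; exists y => //; exists v.
have inf2_le y v : Psi xbar y -> (inf2 <=
    second_subderivative phi (row_mx xbar y) (row_mx xs 0) (row_mx u v))%E.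
  by move=> xy; apply: ereal_inf_lbound; exists y => //; exists v.
have d1_le : (subderivative h xbar u <= inf1)%E.
  by apply: le_ereal_inf_tmp => _ [y xy [v _ <-]]; exact: le1.
have d2_le : (second_subderivative h xbar xs u <= inf2)%E.
  by apply: le_ereal_inf_tmp => _ [y xy [v _ <-]]; exact: le2.
split=> // calm.
have att1 : (subderivative h xbar u < +oo)%E -> exists y v : 'rV[R]_m,
    [/\ Psi xbar y, graphical_derivative Psi xbar y u v &
      subderivative phi (row_mx xbar y) (row_mx u v) = subderivative h xbar u].
  rewrite subderivativeE => fin.
  have [y [v [xy Dv le]]] := marginal_attained phi_lsc
    (rho := id) (fun t t0 => t0) cvg_id hfin calm fin.
  exists y, v; split=> //; apply/eqP; rewrite eq_le -subderivativeE le1// andbT.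
  by rewrite d1phiE subderivativeE.
have att2 : (second_subderivative h xbar xs u < +oo)%E -> exists y v : 'rV[R]_m,
    [/\ Psi xbar y, graphical_derivative Psi xbar y u v &
      second_subderivative phi (row_mx xbar y) (row_mx xs 0) (row_mx u v) =
      second_subderivative h xbar xs u].
  move=> fin.
  have [y [v [xy Dv le]]] := marginal_attained phi_lsc
    (@halfsq_gt0 R) (@cvg_halfsq R) hfin calm fin.
  by exists y, v; split=> //; apply/eqP; rewrite eq_le le2// le.
have eq1 : subderivative h xbar u = inf1.
  apply/eqP; rewrite eq_le d1_le/=.
  have [/eqP->|] := boolP (subderivative h xbar u == +oo%E); first exact: leey.
  by rewrite -ltey => /att1[y [v [xy _ <-]]]; exact: inf1_le.
have eq2 : second_subderivative h xbar xs u = inf2.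
  apply/eqP; rewrite eq_le d2_le/=.
  have [/eqP->|] := boolP (second_subderivative h xbar xs u == +oo%E).
    exact: leey.
  by rewrite -ltey => /att2[y [v [xy _ <-]]]; exact: inf2_le.
split=> // fin1.
have phi_fin y : Psi xbar y -> phi (row_mx xbar y) = (fine (h xbar))%:E.
  by move=> xy; rewrite fineK// -(marginal_solution xy).
have dotE (v : 'rV[R]_m) : dotv (row_mx xs 0) (row_mx u v) = dotv xs u.
  by rewrite dotv_row_mx0 row_mxKl.
have lt1 : (subderivative h xbar u < +oo)%E.
  by rewrite ltey; move: fin1; rewrite fin_numE => /andP[].
(* Below the slope, both second subderivatives are -oo. *)
have [d1lt|d1ge] := ltP (subderivative h xbar u) (dotv xs u)%:E.
  have [y [v [xy Dv d1E]]] := att1 lt1.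
  exists y, v; split=> //; first by rewrite d1E.
  have d2E : second_subderivative phi (row_mx xbar y) (row_mx xs 0)
      (row_mx u v) = -oo%E.
    by apply: (second_subderivative_eqNy (phi_fin y xy)); rewrite d1E dotE.
  by apply/eqP; rewrite eq_le inf2_le// andbT d2E leNye.
have [d2oo|] := boolP (second_subderivative h xbar xs u == +oo%E).
  have [y [v [xy Dv d1E]]] := att1 lt1.
  exists y, v; split=> //; first by rewrite d1E.
  by apply/eqP; rewrite -eq2 (eqP d2oo) -leye_eq -(eqP d2oo); exact: le2.
rewrite -ltey => d2lt.
have [y [v [xy Dv d2E]]] := att2 d2lt.
exists y, v; split=> //; last by rewrite d2E.
apply/eqP; rewrite eq_le inf1_le// andbT -eq1; apply: le_trans d1ge.
rewrite -(dotE v); apply: (subderivative_le_dotv (phi_fin y xy)).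
by rewrite d2E.
Qed.
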